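(* Let $\Omega=\{1,\dots,d\}^{\mathbb N}$ with the shift $\sigma$, and assume $A:\Omega\to\mathbb R$ depends only on the first two coordinates, $A(x)=A(x_0,x_1)$. Let $x,y,z\in\Omega$ and $n\ge1$. Assume that $d(z,x)\le\frac14$, that $\sigma^n(z)=y$, and that there exists $1\le k<n$ such that $d(\sigma^k(z),x)\le\frac14$. Then $$S_n(A-m(A))(z)\le S_{n-k}(A-m(A))(\sigma^k(z)).$$
   Context: $\Omega$ carries the metric $d(x,y)=2^{-\min\{n:\ x_n\ne y_n\}}$ and $\sigma(x_0x_1x_2\ldots)=x_1x_2\ldots$. $m(A)=\max\int A\,d\nu$ over $\sigma$-invariant Borel probability measures $\nu$ on $\Omega$. $S_n(f)=f+f\circ\sigma+\dots+f\circ\sigma^{n-1}$. *)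

(* Defs.v *)
From HB Require Import structures.
From mathcomp Require Import all_boot all_order all_algebra.
From mathcomp Require Import all_classical all_reals all_analysis.

Set Implicit Arguments.
Unset Strict Implicit.
Unset Printing Implicit Defensive.

Import Order.TTheory GRing.Theory Num.Theory.
Import numFieldNormedType.Exports.

Local Open Scope classical_set_scope.
Local Open Scope ring_scope.

(* The alphabet {1, ..., d} is represented by the d = q.+1 letters of 'I_q.+1, *)
(* so that the full shift is inhabited (as measurable types must be). *)
Definition Omega (q : nat) : Type := nat -> 'I_q.+1.

HB.instance Definition _ (q : nat) := Choice.on (Omega q).
HB.instance Definition _ (q : nat) := isPointed.Build (Omega q) (fun=> ord0).

Definition shift_map (q : nat) (x : Omega q) : Omega q := fun i => x i.+1.

(* 2 ^ - min {n | x_n <> y_n}, the minimum of the empty set being +oo. *)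
Definition Omega_dist (R : realType) (q : nat) (x y : Omega q) : R :=
  match pselect (exists n, x n != y n) with
  | left neq_xy => 2 ^- (ex_minn neq_xy)
  | right _ => 0
  end.

Definition metric_open (R : realType) (q : nat) : set (set (Omega q)) :=
  [set U | forall x, U x ->
     exists2 e : R, 0 < e & forall y, Omega_dist R x y < e -> U y].

Definition borelOmega (R : realType) (q : nat) :=
  g_sigma_algebraType (@metric_open R q).

Definition shift_invariant (R : realType) (q : nat)
    (nu : probability (borelOmega R q) R) : Prop :=
  forall B : set (borelOmega R q), measurable B -> nu (@shift_map q @^-1` B) = nu B.

Definition invariant_integrals (R : realType) (q : nat) (A : Omega q -> R) :
    set R :=
  [set v : R | exists2 nu : probability (borelOmega R q) R,
     shift_invariant nu & v = \int[nu]_x A x].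

(* The supremum is the maximum as soon as the latter exists: see max_meanE. *)
Definition max_mean (R : realType) (q : nat) (A : Omega q -> R) : R :=
  sup (invariant_integrals A).

Lemma max_meanE (R : realType) (q : nat) (A : Omega q -> R) (v : R) :
  invariant_integrals A v -> ubound (invariant_integrals A) v -> max_mean A = v.
Proof.
move=> Av ubv; apply/eqP; rewrite eq_le; apply/andP; split.
  by apply: ge_sup => //; exists v.
by apply: ub_le_sup => //; exists v.
Qed.

Definition birkhoff_sum (R : realType) (q : nat) (n : nat) (f : Omega q -> R)
    (x : Omega q) : R :=
  \sum_(i < n) f (iter i (@shift_map q) x).

Definition depends_on_two_coordinates (R : realType) (q : nat)
    (A : Omega q -> R) : Prop :=
  forall x y : Omega q, x 0%N = y 0%N -> x 1%N = y 1%N -> A x = A y.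

(* Main.v *)
(* Since [z] and [sigma^k z] both agree with [x] on the first two coordinates,
   [z_k = z_0], so the word [z_0 ... z_(k-1)] can be repeated into a [k]-periodic
   point [p].  As [A] only sees two consecutive letters, [S_k A z = S_k A p],
   which is [k] times the integral of [A] for the uniform measure on the orbit
   of [p]; hence [S_k A z <= k * m(A)].  Cutting [S_n] at time [k] concludes. *)
Require Import Defs.
From HB Require Import structures.
From mathcomp Require Import all_boot all_order all_algebra.
From mathcomp Require Import all_classical all_reals all_analysis.
From mathcomp Require Import measurable_realfun.
Import Order.TTheory GRing.Theory Num.Theory.
Import numFieldNormedType.Exports.
Local Open Scope ring_scope.

Section empirical_measure.
Context (d : measure_display) (T : measurableType d) (R : realType).
Variables (a : nat -> T) (N : nat).
Local Open Scope ereal_scope.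

(** Average of the Dirac masses at [a 0], ..., [a N], counted with multiplicity, so for an orbit any
    period serves, minimal or not. The index [N.+1] keeps the normalising factor well defined. *)
Definition empirical : set T -> \bar R :=
  mscale (N.+1%:R^-1)%:nng%R (msum (fun i => \d_(a i)) N.+1).

HB.instance Definition _ := Measure.on empirical.

Lemma empiricalE (B : set T) :
  empirical B = (N.+1%:R^-1 * \sum_(i < N.+1) (a i \in B)%:R)%R%:E.
Proof.
by rewrite /empirical /mscale /msum EFinM/= -sumEFin; congr (_ * _).
Qed.

Let empirical_setT : empirical setT = 1.
Proof.
rewrite empiricalE (eq_bigr (fun=> 1%R)) => [|i _]; last by rewrite in_setT.
by rewrite sumr_const card_ord mulVf// pnatr_eq0.
Qed.

HB.instance Definition _ :=
  Measure_isProbability.Build _ _ _ empirical empirical_setT.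

Lemma ge0_integral_empirical (f : T -> \bar R) :
  measurable_fun [set: T] f -> (forall x, 0 <= f x) ->
  \int[empirical]_x f x = (N.+1%:R^-1)%R%:E * \sum_(i < N.+1) f (a i).
Proof.
move=> mf f0; rewrite ge0_integral_mscale// ge0_integral_measure_sum//.
congr (_ * _); apply: eq_bigr => i _.
by rewrite integral_dirac// diracT mul1e.
Qed.

Lemma Rintegral_empirical (f : T -> R) : measurable_fun [set: T] f ->
  (\int[empirical]_x f x = N.+1%:R^-1 * \sum_(i < N.+1) f (a i))%R.
Proof.
move=> mf; have mEf : measurable_fun setT (EFin \o f) by exact/measurable_EFinP.
(* The nonnegative formula is applied to the positive and negative parts of [f], which are then
   recombined term by term. *)
rewrite /Rintegral integralE !ge0_integral_empirical//.
- rewrite funerpos funerneg !sumEFin -!EFinM -EFinB /=.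
  rewrite -mulrBr -sumrB; congr (_ * _)%R; apply: eq_bigr => i _.
  by rewrite -[in RHS](funrposBneg f).
- exact: measurable_funeneg.
- exact: measurable_funepos.
Qed.

End empirical_measure.

Section full_shift.
Context (R : realType) (q : nat).
Implicit Types (x y : Omega q) (A : Omega q -> R).

Lemma iter_shift_mapE x i j : iter i (@shift_map q) x j = x (i + j)%N.
Proof. by elim: i j => //= i IH j; rewrite /shift_map IH addSnnS. Qed.

Lemma Omega_dist_le_agree x y (m i : nat) :
  Omega_dist R x y <= 2 ^- m.+1 -> (i <= m)%N -> x i = y i.
Proof.
rewrite /Omega_dist; case: pselect => [neq_xy|eq_xy _ _]; last first.
  by apply: contrapT => /eqP xy; apply: eq_xy; exists i.
case: ex_minnP => j _ min_j; rewrite lef_pV2 ?posrE ?exprn_gt0//.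
rewrite ler_eXn2l ?ltr1n// => mj im; apply: contrapT => /eqP /min_j ji.
by move: (leq_ltn_trans (leq_trans ji im) mj); rewrite ltnn.
Qed.

(** Preimages under [A] are open: a ball of radius 1/4 fixes the first two letters, hence the value
    of [A]. *)
Lemma measurable_two_coordinates A : depends_on_two_coordinates A ->
  measurable_fun [set: borelOmega R q] A.
Proof.
move=> hA _ Y _; rewrite setTI; apply: sub_sigma_algebra => x /= Yx.
exists (2 ^- 2) => [|y /ltW xy]; first by rewrite invr_gt0 exprn_gt0.
by rewrite /= -(hA x y)//; apply: Omega_dist_le_agree xy _.
Qed.

Lemma bounded_two_coordinates A : depends_on_two_coordinates A ->
  exists M : R, forall x, `|A x| <= M.
Proof.
move=> hA; pose w (ab : 'I_q.+1 * 'I_q.+1) : Omega q :=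
  fun i => if i is 0%N then ab.1 else ab.2.
(* [A] takes one value per pair of letters, and each absolute value is at most the finite sum of all
   of them. *)
exists (\sum_ab `|A (w ab)|) => x.
rewrite (hA x (w (x 0%N, x 1%N)))// (bigD1 (x 0%N, x 1%N))//= lerDl.
exact: sumr_ge0.
Qed.

(** [max_mean] is a [sup], so boundedness is what lets it dominate the integral for a given
    invariant measure. *)
Lemma has_ubound_invariant_integrals A : depends_on_two_coordinates A ->
  has_ubound (invariant_integrals A).
Proof.
move=> hA; have [M AM] := bounded_two_coordinates A hA.
exists M => _ [nu _ ->].
have fin_nuT : (nu setT < +oo)%E by rewrite probability_setT ltry.
rewrite -[M]mulr1 -[1%R]/(fine 1%E) -(@probability_setT _ _ _ nu).
rewrite -Rintegral_cst//; apply: le_Rintegral => //.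
- apply: measurable_bounded_integrable => //.
    exact: measurable_two_coordinates.
  exists M; split; first exact: num_real.
  by move=> r Mr x _ /=; exact: le_trans (AM x) (ltW Mr).
- exact: finite_measure_integrable_cst.
- by move=> x _; exact: le_trans (ler_norm _) (AM x).
Qed.

Lemma birkhoff_sum_periodic_le A (p : Omega q) (N : nat) :
  depends_on_two_coordinates A -> iter N.+1 (@shift_map q) p = p ->
  birkhoff_sum N.+1 A p <= N.+1%:R * max_mean A.
Proof.
move=> hA per_p; rewrite -ler_pdivrMl ?ltr0n//.
apply: ub_le_sup; first exact: has_ubound_invariant_integrals.
pose orb i : borelOmega R q := iter i (@shift_map q) p.
exists (empirical _ _ R orb N : probability _ _); last first.
  by rewrite Rintegral_empirical//; exact: measurable_two_coordinates.
move=> B _; rewrite [LHS]empiricalE [RHS]empiricalE; congr (_ * _)%:E.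
(* Invariance: the preimage under the shift counts the orbit points of index 1 to [N.+1] in place of
   0 to [N]; the two sums differ only in their end terms, which agree by periodicity. *)
rewrite big_ord_recr [RHS]big_ord_recl [RHS]addrC/=; congr (_ + _).
by rewrite -[RHS]/((p \in B)%:R) -per_p.
Qed.

Lemma birkhoff_sum_return_le A x (N : nat) :
  depends_on_two_coordinates A -> x N.+1 = x 0%N ->
  birkhoff_sum N.+1 A x <= N.+1%:R * max_mean A.
Proof.
move=> hA xN; pose p : Omega q := fun i => x (i %% N.+1)%N.
have per_p : iter N.+1 (@shift_map q) p = p.
  by apply: funext => j; rewrite iter_shift_mapE /p modnDl.
rewrite (_ : birkhoff_sum N.+1 A x = birkhoff_sum N.+1 A p).
  exact: birkhoff_sum_periodic_le.
apply: eq_bigr => i _; apply: hA; rewrite !iter_shift_mapE /p.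
  by rewrite addn0 modn_small.
(* Only at [i = N] does the second letter wrap around to index 0; there [x N.+1 = x 0] closes the
   gap. *)
rewrite addn1; have [iN|] := ltnP i.+1 N.+1; first by rewrite modn_small.
by move=> Ni; have /eqP -> : i.+1 == N.+1; rewrite ?modnn// eqn_leq Ni ltn_ord.
Qed.

Lemma birkhoff_sumD (m n : nat) A x :
  birkhoff_sum (m + n) A x =
  birkhoff_sum m A x + birkhoff_sum n A (iter m (@shift_map q) x).
Proof.
rewrite /birkhoff_sum big_split_ord/=; congr (_ + _).
by apply: eq_bigr => i _; rewrite addnC iterD.
Qed.

Lemma birkhoff_sumB_cst (n : nat) A (c : R) x :
  birkhoff_sum n (fun u => A u - c) x = birkhoff_sum n A x - n%:R * c.
Proof. by rewrite /birkhoff_sum sumrB sumr_const card_ord mulr_natl. Qed.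

End full_shift.

Theorem lemma4p5 (R : realType) (q : nat) (A : Omega q -> R)
    (hA : depends_on_two_coordinates A)
    (x y z : Omega q) (n : nat) (hn : (1 <= n)%N)
    (hzx : Omega_dist R z x <= 1 / 4)
    (hzy : iter n (@shift_map q) z = y)
    (k : nat) (hk1 : (1 <= k)%N) (hkn : (k < n)%N)
    (hkx : Omega_dist R (iter k (@shift_map q) z) x <= 1 / 4) :
  birkhoff_sum n (fun u => A u - max_mean A) z
    <= birkhoff_sum (n - k) (fun u => A u - max_mean A) (iter k (@shift_map q) z).
Proof.
have quarter : 1 / 4 = 2 ^- 2 :> R by rewrite div1r -natrX.
rewrite quarter in hzx hkx.
have zk : z k = z 0%N.
  rewrite (Omega_dist_le_agree _ _ _ _ _ 0 hzx)//.
  by rewrite -(Omega_dist_le_agree _ _ _ _ _ 0 hkx)// iter_shift_mapE addn0.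
(* With [n = k + (n - k)] the tail is the right-hand side, leaving the sum over the first [k] terms
   to be shown nonpositive. *)
rewrite -[in leLHS](subnKC (ltnW hkn)) birkhoff_sumD gerDr.
rewrite birkhoff_sumB_cst subr_le0.
by case: k hk1 zk {hkn hkx} => // N _ zN; exact: birkhoff_sum_return_le.
Qed.
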